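(* Let $G$ be a finite simple graph of diameter $2$ with $n$ vertices and $m$ edges, where $n\geq3$. Let $n_i$ be the number of vertices of $2$-distance neighborhood degree $i$, and let $d$ and $D$ be the minimum and maximum $2$-distance neighborhood degree of $G$. Assume $d\neq 0$ and $d\neq D$. Let $\alpha\in\mathbb{R}$ with $\alpha\notin\{0,1\}$, put $S_\alpha=\frac{D^\alpha-d^\alpha}{D-d}$, and let $M_1=\sum_{u\in V(G)}\deg(u)^2$. Then: \begin{enumerate} \item $NM2_\alpha(G)=nd^\alpha+(2m(n-1)-M_1-nd)S_\alpha+\sum_{i=1}^{D-d-1}n_{d+i}\left[(d+i)^\alpha-d^\alpha-iS_\alpha\right].$ \item $NM2_\alpha(G)=nd^\alpha+(2m(n-1)-M_1-nd)\big((d+1)^\alpha-d^\alpha\big)+\sum_{i=2}^{D-d}n_{d+i}\left[(d+i)^\alpha-d^\alpha-i\big((d+1)^\alpha-d^\alpha\big)\right].$ \end{enumerate}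
   Context: For a vertex $v$ of a graph $G$, $\deg(v)$ denotes its degree. The $2$-distance neighborhood degree $\delta_2(v)$ of $v$ is the sum of the degrees of the vertices at distance exactly $2$ from $v$. For real $\alpha\notin\{0,1\}$, the general $2$-distance neighborhood degree index is $NM2_\alpha(G)=\sum_{u\in V(G)}\delta_2(u)^\alpha$. The first Zagreb index is $M_1(G)=\sum_{u\in V(G)}\deg(u)^2$. *)

(* Defs.v *)
From mathcomp Require Import all_boot all_order all_algebra.
From mathcomp Require Import reals exp.

Set Implicit Arguments.
Unset Strict Implicit.
Unset Printing Implicit Defensive.

Import GRing.Theory Num.Theory.

(* A finite simple graph is a symmetric irreflexive relation [e] on a finType. *)

Section Graph.
Variables (T : finType) (e : rel T).

Definition deg (v : T) : nat := #|[set w | e v w]|.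

Definition edges : {set {set T}} :=
  [set E | [exists x, exists y, e x y && (E == [set x; y])]].

Definition walk (x y : T) (k : nat) : bool :=
  [exists p : k.-tuple T, path e x p && (last x p == y)].

(* The least length of a walk from [x] to [y]; a shortest walk has length
   < #|T|, and the value is #|T| when [y] is not reachable from [x]. *)
Definition gdist (x y : T) : nat := find (walk x y) (iota 0 #|T|).

Definition connected_graph : bool := [forall x, forall y, connect e x y].

(* Only meaningful for connected graphs. *)
Definition diameter : nat := \max_x \max_y gdist x y.

Definition delta2 (v : T) : nat := \sum_(w | gdist v w == 2) deg w.

Definition max_delta2 : nat := \max_v delta2 v.

(* The unit [max_delta2] of the iterated minimum is an upper bound of all the
   values, hence does not affect the result on a nonempty graph. *)
Definition min_delta2 : nat := \big[minn/max_delta2]_v delta2 v.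

Definition num_delta2 (i : nat) : nat := #|[set v | delta2 v == i]|.

Definition zagreb1 : nat := \sum_v deg v ^ 2.

Local Open Scope ring_scope.

(* [0 `^ a = 0] for [a != 0]; thus for [a < 0] the index is meaningful only
   when no [delta2 v] is zero. *)
Definition NM2 (R : realType) (a : R) : R := \sum_v (delta2 v)%:R `^ a.

End Graph.

(* Main.v *)
Require Import Defs.
From mathcomp Require Import all_boot all_order all_algebra.
From mathcomp Require Import reals exp.
From mathcomp Require Import zify ring.
Import GRing.Theory Num.Theory.
Local Open Scope ring_scope.

(** In a graph of diameter 2 the vertices at distance 2 from [v] are exactly the
    other non-neighbours of [v], so double counting and the handshake lemma give
    [sum_v delta2 v = sum_w deg w * (n - 1 - deg w) = 2 m (n - 1) - M1].
    Subtracting from [x `^ alpha] the line of slope [s] through its value at [d],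
    and collecting vertices by the value [d + i] of [delta2], yields an identity
    valid for every [s], whose [i = 0] term vanishes.  The two formulas
    are the chord slopes over [[d, D]] and over [[d, d + 1]], which also kill the
    terms [i = D - d] and [i = 1] respectively. *)

Section GraphCounting.
Variables (T : finType) (e : rel T).
Hypotheses (e_sym : symmetric e) (e_irr : irreflexive e).

(** Both sides count ordered pairs of adjacent vertices, grouped by first component or by underlying
    edge. *)
Lemma sum_deg_edges : (\sum_v deg e v = 2 * #|edges e|)%N.
Proof.
have -> : (\sum_v deg e v = \sum_(p : T * T | e p.1 p.2) 1)%N.
  rewrite -(pair_big_dep predT e (fun _ _ => 1%N)) /=.
  by apply: eq_bigr => v _; rewrite sum1_card /deg cardsE.
rewrite (partition_big (fun p : T * T => [set p.1; p.2])
           (mem (edges e))) /=; last first.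
  move=> [x y] /= exy; rewrite inE; apply/existsP; exists x.
  by apply/existsP; exists y; rewrite exy eqxx.
rewrite mulnC -sum_nat_const; apply: eq_bigr => E.
rewrite inE => /existsP[x /existsP[y /andP[exy /eqP ->]]].
have nxy : x != y by apply: contraTneq exy => ->; rewrite e_irr.
(* The fibre over an edge is its two orientations, distinct because there are no loops. *)
rewrite sum1_card (eq_card (B := [set (x, y); (y, x)])).
  by rewrite cards2 xpair_eqE (negPf nxy).
move=> [a b]; rewrite !inE unfold_in /= !xpair_eqE.
apply/andP/orP => [[eab /eqP Eab]|[] /andP[/eqP -> /eqP ->]]; last 2 first.
- by [].
- by rewrite e_sym exy setUC.
have nab : a != b by apply: contraTneq eab => ->; rewrite e_irr.
have := set21 a b; have := set22 a b; rewrite Eab !inE.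
case/orP => /eqP bE /orP[] /eqP aE; move: nab; rewrite aE bE ?eqxx //; by auto.
Qed.

Lemma walk0E x y : walk e x y 0 = (x == y).
Proof.
apply/existsP/idP => [[p]|/eqP ->]; first by rewrite (tuple0 p).
by exists [tuple]; rewrite /= eqxx.
Qed.

Lemma walk1E x y : walk e x y 1 = e x y.
Proof.
apply/existsP/idP => [[p]|exy].
  by case/tupleP: p => z p; rewrite (tuple0 p) /= andbT => /andP[? /eqP <-].
by exists [tuple y]; rewrite /= exy eqxx.
Qed.

Hypotheses (e_diam : diameter e = 2%N) (T_ge3 : (3 <= #|T|)%N).

Lemma gdist_le2 x y : (gdist e x y <= 2)%N.
Proof.
rewrite -e_diam /diameter.
by apply: leq_trans (leq_bigmax x); apply: leq_trans (leq_bigmax y).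
Qed.

(** As [#|T|] is at least 3, the search list starts with 0, 1, 2. When lengths 0 and 1 fail, the
    diameter bound forces length 2 to succeed. *)
Lemma gdist_eq2 x y : (gdist e x y == 2%N) = (x != y) && ~~ e x y.
Proof.
move: (gdist_le2 x y); rewrite /gdist.
case: #|T| T_ge3 => [|[|[|k]]] //= _; rewrite walk0E walk1E.
by case: (x == y); case: (e x y); case: (walk e x y 2).
Qed.

Lemma card_nonneighbours v :
  (#|[pred w | gdist e w v == 2%N]| + deg e v = #|T|.-1)%N.
Proof.
rewrite -(cardC1 v) -(cardID (e v) (predC1 v)) addnC /deg cardsE.
congr (_ + _)%N; apply: eq_card => w; rewrite !inE unfold_in /=.
  by case: eqP => // ->; rewrite e_irr.
by rewrite gdist_eq2 e_sym andbC.
Qed.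

Lemma sum_delta2 :
  (\sum_v delta2 e v + zagreb1 e = 2 * #|edges e| * #|T|.-1)%N.
Proof.
rewrite /delta2 (exchange_big_dep predT) //= -big_split /= -sum_deg_edges.
rewrite big_distrl; apply: eq_bigr => v _ /=.
(* The square from [zagreb1] completes the number of non-neighbours to [#|T|.-1]. *)
by rewrite sum_nat_const -(card_nonneighbours v) mulnDr mulnn
           [(deg e v * _)%N]mulnC.
Qed.

Lemma min_delta2_le v : (min_delta2 e <= delta2 e v)%N.
Proof.
rewrite /min_delta2; have := mem_index_enum v.
elim: (index_enum T) => // u r IHr; rewrite inE big_cons geq_min.
by case/predU1P => [<-|/IHr ->]; rewrite ?leqnn ?orbT.
Qed.

Lemma delta2_le_max v : (delta2 e v <= max_delta2 e)%N.
Proof. exact: leq_bigmax. Qed.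

Lemma sum_by_delta2 (R : pzRingType) (g : nat -> R) :
  let d := min_delta2 e in let D := max_delta2 e in
  \sum_v g (delta2 e v) =
  \sum_(0 <= i < (D - d).+1) (num_delta2 e (d + i))%:R * g (d + i)%N.
Proof.
move=> d D; rewrite big_mkord.
rewrite (partition_big (fun v => inord (delta2 e v - d) : 'I_(D - d).+1)
           predT) //=.
apply: eq_bigr => i _; rewrite /num_delta2 mulr_natl -sumr_const.
(* Since [delta2 e v] lies between [d] and [D], the truncated subtraction is exact and [inord] never
   takes its default value. *)
have E v : (inord (delta2 e v - d) == i) = (delta2 e v == d + i)%N.
  have := min_delta2_le v; have := delta2_le_max v; rewrite -/d -/D => vD dv.
  rewrite -val_eqE /= inordK; lia.
by apply: eq_big => [v|v]; rewrite ?inE E // => /eqP ->.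
Qed.

Lemma NM2_slope (R : realType) (alpha s : R) :
  let n := #|T| in let d := min_delta2 e in let D := max_delta2 e in
  NM2 e alpha =
    n%:R * d%:R `^ alpha
    + (2 * #|edges e|%:R * (n%:R - 1) - (zagreb1 e)%:R - n%:R * d%:R) * s
    + \sum_(0 <= i < (D - d).+1)
        (num_delta2 e (d + i)%N)%:R
        * ((d + i)%:R `^ alpha - d%:R `^ alpha - i%:R * s).
Proof.
move=> n d D.
pose g k : R := k%:R `^ alpha - d%:R `^ alpha - (k%:R - d%:R) * s.
have gE i : (d + i)%:R `^ alpha - d%:R `^ alpha - i%:R * s = g (d + i)%N.
  by rewrite /g natrD; ring.
under eq_bigr do rewrite gE.
rewrite -sum_by_delta2 /g !sumrB -mulr_suml sumrB !sumr_const.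
(* The cast of [sum_delta2] to [R] evaluates the linear part of the sum of [g]; [natrB] needs a
   nonempty graph. *)
have := congr1 (fun k : nat => k%:R : R) sum_delta2.
rewrite natrD !natrM -subn1 natrB ?natr_sum; last by lia.
rewrite -/n /NM2 => /(canRL (addrK _)) ->.
by rewrite -(mulr_natl (d%:R `^ alpha)) -(mulr_natl d%:R) -/n; ring.
Qed.

End GraphCounting.

Theorem theorem4p2 (R : realType) (T : finType) (e : rel T)
    (e_sym : symmetric e) (e_irr : irreflexive e)
    (e_conn : connected_graph e) (e_diam : diameter e = 2%N) (alpha : R) :
  let n := #|T| in
  let m := #|edges e| in
  let d := min_delta2 e in
  let D := max_delta2 e in
  let n_ := num_delta2 e in
  let M1 := zagreb1 e in
  let S := (D%:R `^ alpha - d%:R `^ alpha) / (D%:R - d%:R) in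
  (3 <= n)%N -> d <> 0%N -> d <> D -> alpha <> 0 -> alpha <> 1 ->
  NM2 e alpha =
    n%:R * d%:R `^ alpha
    + (2 * m%:R * (n%:R - 1) - M1%:R - n%:R * d%:R) * S
    + \sum_(1 <= i < D - d)
        (n_ (d + i)%N)%:R
        * ((d + i)%:R `^ alpha - d%:R `^ alpha - i%:R * S)
  /\
  NM2 e alpha =
    n%:R * d%:R `^ alpha
    + (2 * m%:R * (n%:R - 1) - M1%:R - n%:R * d%:R)
      * ((d + 1)%:R `^ alpha - d%:R `^ alpha)
    + \sum_(2 <= i < (D - d).+1)
        (n_ (d + i)%N)%:R
        * ((d + i)%:R `^ alpha - d%:R `^ alpha
           - i%:R * ((d + 1)%:R `^ alpha - d%:R `^ alpha)).
Proof.
move=> n m d D n_ M1 S n_ge3 _ /eqP d_neq_D _ _.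
(* Any vertex witnesses that the minimum is at most the maximum. *)
have lt_dD : (d < D)%N.
  have /card_gt0P[v _] : (0 < #|T|)%N by apply: leq_trans n_ge3.
  rewrite ltn_neqAle d_neq_D.
  exact: leq_trans (min_delta2_le _ _ v) (delta2_le_max _ _ v).
have DdK : (d + (D - d))%N = D by rewrite subnKC // ltnW.
have NM2E := NM2_slope _ _ e_sym e_irr e_diam n_ge3 _ alpha.
split.
(* Both end terms are split off; the last one vanishes because [(D - d) * S] is the full increment,
   where the division needs [d] different from [D]. *)
- rewrite (NM2E S) -/n -/d -/D big_nat_recr //= big_ltn ?subn_gt0 // addn0 subrr mul0r subrr mulr0.
  rewrite add0r DdK natrB 1?ltnW // [_ * S]mulrC divfK ?subrr ?mulr0 ?addr0 //.
  by rewrite subr_eq0 eqr_nat eq_sym.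
- rewrite (NM2E ((d + 1)%:R `^ alpha - d%:R `^ alpha)) -/n -/d -/D.
  (* The index 1 is in range because [d < D]. *)
  rewrite big_ltn // big_ltn ?ltnS ?subn_gt0 //.
  by rewrite addn0 subrr mul0r subrr mulr0 mul1r subrr mulr0 !add0r.
Qed.
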